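(* For every pair of equations $E,E'$ in the unknowns $x_1,\dots,x_n$ and every $1\le k<\ell\le n$, the polynomial $t_{k\ell}^{E,E'}$ contains at most $2(|E|_{x_k}+|E|_{x_\ell})$ minimal monomials.
   Context: An equation is a pair $E=(u,v)$ of words over $\{x_1,\dots,x_n\}$; $|E|_x=|u|_x+|v|_x$, the number of occurrences of $x$. For $E=(x_{i_1}\cdots x_{i_r},\,x_{j_1}\cdots x_{j_s})$, $S_{E,x_j}=\sum_{a:\,i_a=j}\prod_{t=1}^{a-1}X_{i_t}-\sum_{a:\,j_a=j}\prod_{t=1}^{a-1}X_{j_t}\in\mathbb Z[X_1,\dots,X_n]$ (empty product $=1$), and $t_{k\ell}^{E,E'}=S_{E,x_k}S_{E',x_\ell}-S_{E',x_k}S_{E,x_\ell}$. Writing a polynomial as $p=\sum_\beta c_\beta\mathbf X^\beta$ ($\mathbf X^\beta=\prod X_i^{(\beta)_i}$), a monomial $\mathbf X^\beta$ with $c_\beta\ne0$ is minimal in $p$ if no $\beta'\ne\beta$ with $c_{\beta'}\ne0$ satisfies $\beta'\le\beta$ componentwise; the number of minimal monomials is the number of such $\beta$. *)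

(* Defs.v *)
(* Multivariate integer polynomials are not in the installed
   libraries, so we represent an element of Z[X_1..X_n] as a formal finite sum
   of terms (coefficient, exponent vector); its coefficient at a monomial is the
   sum of the coefficients of the terms carrying that monomial. *)
From HB Require Import structures.
From mathcomp Require Import all_boot all_order all_algebra.
Set Implicit Arguments. Unset Strict Implicit. Unset Printing Implicit Defensive.
Import Order.TTheory GRing.Theory Num.Theory.
Local Open Scope ring_scope.

Definition mono (n : nat) := {ffun 'I_n -> nat}.

Definition mpoly (n : nat) := seq (int * mono n).

Definition mcoef n (p : mpoly n) (b : mono n) : int :=
  \sum_(t <- p | t.2 == b) t.1.

Definition in_supp n (p : mpoly n) (b : mono n) : bool :=
  (b \in map snd p) && (mcoef p b != 0).

Definition mono_le n (b b' : mono n) : bool := [forall i, b i <= b' i]%N.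

Definition minimal_mono n (p : mpoly n) (b : mono n) : bool :=
  in_supp p b &&
  ~~ has (fun b' => [&& b' != b, in_supp p b' & mono_le b' b]) (map snd p).

Definition num_minimal n (p : mpoly n) : nat :=
  count (minimal_mono p) (undup (map snd p)).

Definition mp_mul n (p q : mpoly n) : mpoly n :=
  [seq (a.1 * b.1, ([ffun i => (a.2 i + b.2 i)%N] : mono n)) | a : int * mono n <- p, b : int * mono n <- q].

Definition mp_sub n (p q : mpoly n) : mpoly n :=
  p ++ [seq (- a.1, a.2) | a : int * mono n <- q].

Definition mexp n (s : seq 'I_n) : mono n := [ffun i => count_mem i s].

Definition equation (n : nat) := (seq 'I_n * seq 'I_n)%type.

(* sum over positions a (0-indexed) with s_a = j of X^(s_0 ... s_{a-1}) *)
Definition Sword n (s : seq 'I_n) (j : 'I_n) : mpoly n :=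
  [seq (1%:Z, mexp (take a s)) | a <- iota 0 (size s) & nth j s a == j].

Definition S_E n (E : equation n) (j : 'I_n) : mpoly n :=
  mp_sub (Sword E.1 j) (Sword E.2 j).

Definition t_kl n (E E' : equation n) (k l : 'I_n) : mpoly n :=
  mp_sub (mp_mul (S_E E k) (S_E E' l)) (mp_mul (S_E E' k) (S_E E l)).

Definition occ n (E : equation n) (x : 'I_n) : nat :=
  (count_mem x E.1 + count_mem x E.2)%N.

(* Main.v *)
(** Every monomial of [t_kl] has the form X^(u_<a) X^(v_<b), where u_<a is
    the prefix before an occurrence a of x_k (resp. x_l) in a side u of E and
    v is a side of E'.  Fixing (u, a, v) and letting b vary yields a chain for
    the componentwise order, since prefixes of v grow with b.  Minimal monomials
    are pairwise incomparable, so each chain carries at most one of them, and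
    there are 2|E|_{x_k} + 2|E|_{x_l} such chains. *)
Require Import Defs.
From mathcomp Require Import all_boot all_order all_algebra.
From mathcomp Require Import zify.
Set Implicit Arguments. Unset Strict Implicit. Unset Printing Implicit Defensive.

Lemma antichain_size_le_chain_cover (T I : eqType) (le : rel T)
    (on_chain : T -> I -> bool) (L : seq T) (C : seq I) :
  uniq L ->
  {in L &, forall x y, le x y -> x = y} ->
  {in L, forall x, has (on_chain x) C} ->
  (forall x y c, on_chain x c -> on_chain y c -> le x y || le y x) ->
  (size L <= size C)%N.
Proof.
move=> uniqL antichainL coverL chainC.
case: C coverL => [|c0 C'] coverL.
  by case: L {uniqL antichainL} coverL => // x L /(_ x (mem_head x L)).
set C := c0 :: C'; pose f x := nth c0 C (find (on_chain x) C).
have on_chain_f x : x \in L -> on_chain x (f x) by move/coverL; apply: nth_find.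
have f_inj : {in L &, injective f}.
  move=> x y Lx Ly fxy; have := on_chain_f x Lx; rewrite fxy => /chainC.
  by move=> /(_ _ (on_chain_f y Ly)) /orP [] /antichainL; [apply | move=> -> //].
rewrite -(size_map f); apply: uniq_leq_size; first by rewrite map_inj_in_uniq.
by move=> _ /mapP [x Lx ->]; rewrite mem_nth // -has_find coverL.
Qed.

Definition mono_add n (b b' : mono n) : mono n := [ffun i => (b i + b' i)%N].

Lemma mono_addC n (b b' : mono n) : mono_add b b' = mono_add b' b.
Proof. by apply/ffunP => i; rewrite !ffunE addnC. Qed.

Lemma mono_le_add2l n (b b1 b2 : mono n) :
  mono_le b1 b2 -> mono_le (mono_add b b1) (mono_add b b2).
Proof. by move=> /forallP le12; apply/forallP => i; rewrite !ffunE leq_add2l. Qed.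

Lemma mono_le_mexp_take n (s : seq 'I_n) a b :
  (a <= b)%N -> mono_le (mexp (take a s)) (mexp (take b s)).
Proof.
by move=> ab; apply/forallP => i; rewrite !ffunE -(subnKC ab) takeD count_cat leq_addr.
Qed.

Lemma minimal_mono_antisym n (p : mpoly n) b b' :
  minimal_mono p b -> minimal_mono p b' -> mono_le b b' -> b = b'.
Proof.
move=> /andP [supp_b _] /andP [_ no_below_b'] le_bb'.
apply/eqP; apply: contraNT no_below_b' => neq_bb'; apply/hasP; exists b.
  by case/andP: supp_b.
by rewrite neq_bb' supp_b le_bb'.
Qed.

Definition positions n (s : seq 'I_n) (j : 'I_n) : seq nat :=
  [seq a <- iota 0 (size s) | nth j s a == j].

Lemma size_positions n (s : seq 'I_n) j : size (positions s j) = count_mem j s.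
Proof.
rewrite size_filter -[in RHS](mkseq_nth j s) count_map.
exact: eq_count.
Qed.

Lemma mem_positions_lt n (s : seq 'I_n) j a : a \in positions s j -> (a < size s)%N.
Proof. by rewrite mem_filter mem_iota => /andP []. Qed.

Definition sides n (E : equation n) : seq (seq 'I_n) := [:: E.1; E.2].

Lemma support_mp_sub n (p q : mpoly n) : map snd (mp_sub p q) = map snd p ++ map snd q.
Proof. by rewrite map_cat -map_comp. Qed.

Lemma support_mp_mul n (p q : mpoly n) :
  map snd (mp_mul p q) = [seq mono_add b b' | b <- map snd p, b' <- map snd q].
Proof. by rewrite map_allpairs allpairs_mapl allpairs_mapr. Qed.

Lemma support_S_E n (E : equation n) j :
  map snd (S_E E j) = [seq mexp (take a u) | u <- sides E, a <- positions u j].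
Proof. by rewrite support_mp_sub /= cats0 /Sword -!map_comp. Qed.

(** [(P, v)] encodes the chain P X^(v_<0) <= P X^(v_<1) <= ... <= P X^v. *)
Definition on_chain n (b : mono n) (c : mono n * seq 'I_n) : bool :=
  has (fun i => b == mono_add c.1 (mexp (take i c.2))) (iota 0 (size c.2).+1).

Lemma on_chain_comparable n (b b' : mono n) c :
  on_chain b c -> on_chain b' c -> mono_le b b' || mono_le b' b.
Proof.
move=> /hasP [i _ /eqP ->] /hasP [i' _ /eqP ->].
by case: (leqP i i') => [|/ltnW] /(mono_le_mexp_take c.2) /(mono_le_add2l c.1) ->;
  rewrite ?orbT.
Qed.

Definition prefix_chains n (u : seq 'I_n) (j : 'I_n) (V : seq (seq 'I_n)) :
    seq (mono n * seq 'I_n) :=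
  [seq (mexp (take a u), v) | a <- positions u j, v <- V].
Arguments prefix_chains : simpl never.

Lemma size_prefix_chains n (u : seq 'I_n) j V :
  size (prefix_chains u j V) = (count_mem j u * size V)%N.
Proof. by rewrite size_allpairs size_positions. Qed.

Definition chain_cover n (E E' : equation n) (k l : 'I_n) : seq (mono n * seq 'I_n) :=
  flatten [seq prefix_chains u j (sides E') | j <- [:: k; l], u <- sides E].

Lemma size_chain_cover n (E E' : equation n) k l :
  size (chain_cover E E' k l) = (2 * (occ E k + occ E l))%N.
Proof. by rewrite size_flatten /= !size_prefix_chains /occ /sides /=; lia. Qed.

Lemma chain_cover_on_chain n (E E' : equation n) k l u j a v b :
  u \in sides E -> j \in [:: k; l] -> a \in positions u j -> v \in sides E' ->
  (b <= size v)%N ->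
  has (on_chain (mono_add (mexp (take a u)) (mexp (take b v)))) (chain_cover E E' k l).
Proof.
move=> Eu jkl ua E'v bv; apply/hasP; exists (mexp (take a u), v).
  apply/flattenP; exists (prefix_chains u j (sides E')).
    exact: (allpairs_f (fun j u => prefix_chains u j (sides E'))).
  exact: (allpairs_f (fun a v => (mexp (take a u), v))).
by apply/hasP; exists b; rewrite // mem_iota /= ltnS.
Qed.

Lemma support_t_kl_covered n (E E' : equation n) k l b :
  b \in map snd (t_kl E E' k l) -> has (on_chain b) (chain_cover E E' k l).
Proof.
rewrite support_mp_sub !support_mp_mul !support_S_E mem_cat.
case/orP => /allpairsP [[x y] [/allpairsPdep [u [a [Eu ua ->]]]
                               /allpairsPdep [v [c [E'v vc ->]]] ->]] /=.
- apply: (chain_cover_on_chain Eu _ ua E'v (ltnW (mem_positions_lt vc))).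
  by rewrite !inE eqxx.
- rewrite mono_addC; apply: (chain_cover_on_chain E'v _ vc Eu (ltnW (mem_positions_lt ua))).
  by rewrite !inE eqxx orbT.
Qed.

Theorem lemma4p4 (n : nat) (E E' : equation n) (k l : 'I_n) :
  (k < l)%N ->
  (num_minimal (t_kl E E' k l) <= 2 * (occ E k + occ E l))%N.
Proof.
move=> _.
rewrite /num_minimal -size_filter -(size_chain_cover E E' k l).
apply: (@antichain_size_le_chain_cover _ _ (@mono_le n) (@on_chain n)).
- by rewrite filter_uniq ?undup_uniq.
- move=> b b'; rewrite !mem_filter => /andP [min_b _] /andP [min_b' _].
  exact: minimal_mono_antisym min_b min_b'.
- by move=> b; rewrite mem_filter mem_undup => /andP [_]; apply: support_t_kl_covered.
- exact: on_chain_comparable.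
Qed.
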